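(* Let $X$ be a path connected space. (i) If $X$ contains no non-trivial pointed small loop, then $X$ is (weakly) homotopically Hausdorff. (ii) If $X$ contains no non-trivial free small loop, then $X$ is strongly homotopically Hausdorff. (iii) If $X$ is a locally path connected metric space and there is no pair of paths $f,g\colon[0,1]\to X$ such that $f$ is close to $g$ relatively to $\{0,1\}$, then $X$ is homotopically path-Hausdorff.
   Context: All maps are continuous. Homotopically Hausdorff: a space $X$ is (weakly) homotopically Hausdorff if for every $x_0\in X$ and every non-trivial $\gamma\in\pi_1(X,x_0)$ there is a neighbourhood $U$ of $x_0$ such that no loop in $U$ is homotopic (in $X$) to $\gamma$ rel. $x_0$. Strongly homotopically Hausdorff: for every $x_0\in X$ and every essential closed curve $\gamma$ in $X$ there is a neighbourhood of $x_0$ that contains no closed curve freely homotopic (in $X$) to $\gamma$. Homotopically path-Hausdorff: for every path $w\colon[0,1]\to X$ with $w(0)=P$, $w(1)=Q$ and every non-trivial homotopy class $\alpha\in\pi_1(X,P)$ there exist finitely many open sets $U(P_1),\dots,U(P_k)$ (with $P_1=P$, $P_k=Q$) covering $w([0,1])$ such that for a suitable partition $0=t_0<t_1<\dots<t_k=1$, $U(P_j)$ covers $w([t_{j-1},t_j])$, $P_j\in w([t_{j-1},t_j])$, and such that for any path $v\colon[0,1]\to X$ satisfying $v(0)=Q$, $v(1)=P$, $P_{k-j+1}\in v([t_{j-1},t_j])$ and $v([t_{j-1},t_j])\subset U(P_{k-j+1})$ for all $j$, the concatenation of $w$ and $v$ does not belong to the homotopy class $\alpha$. Pointed small loop: a loop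 $f\colon(S^1,0)\to(X,x_0)$ (here $0$ denotes the basepoint of $S^1$, and $x_0\in X$ is any point) such that for each open neighbourhood $U$ of $x_0$ there is a basepoint-preserving homotopy in $X$ from $f$ to a loop with image in $U$. It is non-trivial if it is not homotopic, rel. basepoint, to a constant map. Free small loop: a map $f\colon S^1\to X$ for which there is a point $x\in X$ such that for each open neighbourhood $U$ of $x$ there is a free homotopy in $X$ from $f$ to a map with image in $U$. It is non-trivial if it is not freely homotopic to a constant map. Closeness: let $A\subset Y$ be closed and $(X,d)$ a metric space. A map $f\colon Y\to X$ is close to $g\colon Y\to X$ relatively to $A$ if (a) there is no homotopy from $f$ to $g$ fixing all points of $A$; and (b) for each $\varepsilon>0$ there is a homotopy $H_\varepsilon\colon Y\times[0,1]\to X$ with $H_\varepsilon|_{Y\times\{0\}}=f$, $H_\varepsilon(a,t)=g(a)$ for all $a\in A$, $t\in[0,1]$, and $d(H_\varepsilon(y,1),g(y))<\varepsilon$ for all $y\in Y$. *)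

(* Defs.v *)
(* The reals are an arbitrary [R : realType].  A map defined
   on a subspace [D] of a space [T] is a function on [T] that is continuous
   within [D]; its values outside [D] are irrelevant. *)
From mathcomp Require Import all_boot all_order all_algebra.
From mathcomp Require Import mathcomp_extra boolp classical_sets functions.
From mathcomp Require Import set_interval reals topology normedtype.

Set Implicit Arguments.
Unset Strict Implicit.
Unset Printing Implicit Defensive.

Import Order.TTheory GRing.Theory Num.Theory.
Import numFieldNormedType.Exports.
Local Open Scope classical_set_scope.
Local Open Scope ring_scope.

Section Homotopy.
Variable R : realType.

Definition unit_interval : set R := `[0, 1]%classic.

Local Notation I := unit_interval.

Definition circle : set (R * R) := [set z | z.1 ^+ 2 + z.2 ^+ 2 = 1].

Definition circle_pt : R * R := (1, 0).

Definition homotopic_rel (T X : topologicalType) (D A : set T)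
    (f g : T -> X) : Prop :=
  exists H : T * R -> X,
    [/\ {within D `*` I, continuous H},
        forall y, D y -> H (y, 0) = f y,
        forall y, D y -> H (y, 1) = g y
      & forall a t, A a -> I t -> H (a, t) = f a].

Definition homotopic (T X : topologicalType) (D : set T) (f g : T -> X) :=
  homotopic_rel D set0 f g.

(* [A] is meant to be a closed subset of the subspace [D]. *)
Definition close_rel (T : topologicalType) (X : metricType R) (D A : set T)
    (f g : T -> X) : Prop :=
  ~ homotopic_rel D A f g /\
  forall eps : R, 0 < eps -> exists H : T * R -> X,
    [/\ {within D `*` I, continuous H},
        forall y, D y -> H (y, 0) = f y,
        forall a t, A a -> I t -> H (a, t) = g a
      & forall y, D y -> mdist (H (y, 1)) (g y) < eps].

Section Space.
Variable X : topologicalType.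
Implicit Types (x y p q : X) (w v : R -> X) (f g : R * R -> X).

Definition is_path x y w :=
  [/\ {within I, continuous w}, w 0 = x & w 1 = y].

Definition is_loop x w := is_path x x w.

Definition path_connected (A : set X) :=
  forall x y, A x -> A y -> exists2 w, is_path x y w & w @` I `<=` A.

Definition locally_path_connected :=
  forall x (U : set X), nbhs x U ->
    exists V : set X, [/\ open V, V x, V `<=` U & path_connected V].

Definition path_concat w v : R -> X :=
  fun s => if s <= 2^-1 then w (2 * s) else v (2 * s - 1).

Definition loop_class x w : set (R -> X) :=
  [set v | is_loop x v /\ homotopic_rel I [set 0; 1] w v].

(* Elements of the fundamental group are homotopy classes, as sets of loops. *)
Definition pi1 x : set (set (R -> X)) := loop_class x @` is_loop x.

Definition pi1_one x : set (R -> X) := loop_class x (cst x).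

Definition homotopically_Hausdorff :=
  forall x0 (gamma : set (R -> X)), pi1 x0 gamma -> gamma <> pi1_one x0 ->
    exists2 U : set X, nbhs x0 U &
      forall w, is_loop x0 w -> w @` I `<=` U -> ~ gamma w.

Definition closed_curve f := {within circle, continuous f}.

Definition null_homotopic f := exists c : X, homotopic circle f (cst c).

Definition strongly_homotopically_Hausdorff :=
  forall x0 f, closed_curve f -> ~ null_homotopic f ->
    exists2 U : set X, nbhs x0 U &
      forall g, closed_curve g -> g @` circle `<=` U -> ~ homotopic circle f g.

(* The open sets are indexed by [j], so that U(P_i) and U(P_j) may differ even
   if P_i and P_j are the same point. *)
Definition homotopically_path_Hausdorff :=
  forall p q w, is_path p q w ->
  forall alpha : set (R -> X), pi1 p alpha -> alpha <> pi1_one p ->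
  exists (k : nat) (P : nat -> X) (U : nat -> set X) (t : nat -> R),
    [/\ P 1%N = p /\ P k = q,
        forall j, (1 <= j <= k)%N -> open (U j),
        w @` I `<=` \bigcup_(j in [set j | (1 <= j <= k)%N]) U j,
        [/\ t 0%N = 0, t k = 1 & forall j, (1 <= j <= k)%N -> t j.-1 < t j]
      & (forall j, (1 <= j <= k)%N ->
          w @` `[t j.-1, t j]%classic `<=` U j /\
          (w @` `[t j.-1, t j]%classic) (P j)) /\
        forall v, is_path q p v ->
          (forall j, (1 <= j <= k)%N ->
            (v @` `[t j.-1, t j]%classic) (P (k - j + 1)%N) /\
            v @` `[t j.-1, t j]%classic `<=` U (k - j + 1)%N) ->
          ~ alpha (path_concat w v)].

Definition pointed_small_loop x0 f :=
  [/\ closed_curve f, f circle_pt = x0 &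
    forall U : set X, open U -> U x0 ->
      exists g, [/\ closed_curve g, g @` circle `<=` U &
        homotopic_rel circle [set circle_pt] f g]].

Definition trivial_pointed_loop f :=
  homotopic_rel circle [set circle_pt] f (cst (f circle_pt)).

Definition free_small_loop f :=
  closed_curve f /\
  exists x, forall U : set X, open U -> U x ->
    exists g, [/\ closed_curve g, g @` circle `<=` U & homotopic circle f g].

End Space.
End Homotopy.

Arguments unit_interval : clear implicits.
Arguments circle : clear implicits.
Arguments circle_pt : clear implicits.

(* Main.v *)
(* (i) A loop on [0, 1] and a map on the circle carry the same homotopy
   information, so a nontrivial class that is represented in every
   neighbourhood of [x0] is a nontrivial pointed small loop.  (ii) is a direct
   unfolding.  (iii) If a path [w] from [p] to [q] and a nontrivial [alpha]
   violate the path-Hausdorff property, then for every [eps] the uniform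
   partition of [w] gives a return path [v], with reverse [eps]-close to [w],
   such that [w] followed by [v] represents [alpha].  Two such return paths are
   homotopic, since [w] can be cancelled; so the reverse of any of them is
   homotopic to paths arbitrarily close to [w], but not to [w] itself, because
   otherwise [alpha] would be trivial. *)
Require Import Defs.
From mathcomp Require Import all_boot all_order all_algebra.
From mathcomp Require Import mathcomp_extra boolp classical_sets functions.
From mathcomp Require Import set_interval reals topology normedtype.
From mathcomp Require Import interval_inference realfun lra.

Import Order.TTheory GRing.Theory Num.Theory.
Import numFieldNormedType.Exports.
Local Open Scope classical_set_scope.
Local Open Scope ring_scope.

(** * Continuity of explicit formulas in real coordinates *)

Section Continuity.
Context {R : realType} {S T U : topologicalType}.

Lemma continuous_pair (f : S -> T) (g : S -> U) :
  continuous f -> continuous g -> continuous (fun x => (f x, g x)).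
Proof. by move=> cf cg x; apply: cvg_pair; [exact: cf|exact: cg]. Qed.

Lemma continuous_fst_comp (f : S -> T * U) :
  continuous f -> continuous (fun x => (f x).1).
Proof. by move=> cf x; apply: (cvg_comp _ _ (cf x)); exact: cvg_fst. Qed.

Lemma continuous_snd_comp (f : S -> T * U) :
  continuous f -> continuous (fun x => (f x).2).
Proof. by move=> cf x; apply: (cvg_comp _ _ (cf x)); exact: cvg_snd. Qed.

Lemma continuous_add (f g : S -> R) :
  continuous f -> continuous g -> continuous (fun x => f x + g x).
Proof. by move=> cf cg x; exact: (cvgD (cf x) (cg x)). Qed.

Lemma continuous_opp (f : S -> R) :
  continuous f -> continuous (fun x => - f x).
Proof. by move=> cf x; exact: (cvgN (cf x)). Qed.

Lemma continuous_mul (f g : S -> R) :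
  continuous f -> continuous g -> continuous (fun x => f x * g x).
Proof. by move=> cf cg x; exact: (cvgM (cf x) (cg x)). Qed.

Lemma continuous_normr (f : S -> R) :
  continuous f -> continuous (fun x => `|f x|).
Proof. by move=> cf x; exact: (cvg_norm (cf x)). Qed.

Lemma continuous_sqrt (f : S -> R) :
  continuous f -> continuous (fun x => Num.sqrt (f x)).
Proof.
by move=> cf x; apply: continuous_comp; [exact: cf|exact: sqrt_continuous].
Qed.

End Continuity.

(** Recursion on the head symbol, with subfunctions recovered by second-order patterns. The constant
    case precedes the arithmetic ones, so a factor such as [4^-1] is not decomposed and no rule for
    inverses is required. *)
Ltac prove_continuous :=
  cbv beta;
  lazymatch goal with
  | |- forall x, continuous_at x fst => by move=> ?; exact: cvg_fst
  | |- forall x, continuous_at x snd => by move=> ?; exact: cvg_snd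
  | |- forall x, continuous_at x id => by move=> ?; exact: cvg_id
  | |- forall x, continuous_at x (fun y => y) => by move=> ?; exact: cvg_id
  | |- forall x, continuous_at x (fun _ => ?c) => by move=> ?; exact: cvg_cst
  | |- forall x, continuous_at x (fun y => (@?f y, @?g y)) =>
      apply: (continuous_pair f g); prove_continuous
  | |- forall x, continuous_at x (fun y => (@?f y).1) =>
      apply: (continuous_fst_comp f); prove_continuous
  | |- forall x, continuous_at x (fun y => (@?f y).2) =>
      apply: (continuous_snd_comp f); prove_continuous
  | |- forall x, continuous_at x (fun y => @?f y + @?g y) =>
      apply: (continuous_add f g); prove_continuous
  | |- forall x, continuous_at x (fun y => - @?f y) =>
      apply: (continuous_opp f); prove_continuous
  | |- forall x, continuous_at x (fun y => @?f y * @?g y) =>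
      apply: (continuous_mul f g); prove_continuous
  | |- forall x, continuous_at x (fun y => `|@?f y|) =>
      apply: (continuous_normr f); prove_continuous
  | |- forall x, continuous_at x (fun y => Num.sqrt (@?f y)) =>
      apply: (continuous_sqrt f); prove_continuous
  end.

(** * Continuity on subspaces and pasting *)

Section Within.
Context {S T U : topologicalType}.

Lemma within_comp (A : set S) (B : set T) (f : S -> T) (g : T -> U) :
  {within B, continuous g} -> {within A, continuous f} ->
  (forall x, A x -> B (f x)) -> {within A, continuous (fun x => g (f x))}.
Proof.
move=> /subspace_continuousP cg /subspace_continuousP cf fAB.
apply/subspace_continuousP => x Ax.
apply: (cvg_comp _ _ _ (cg _ (fAB _ Ax))) => W /= BW.
move: (cf _ Ax _ BW); rewrite /nbhs/= /fmap/= /within/=.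
by apply: filterS => y fyW Ay; apply: fyW => //; exact: fAB.
Qed.

Lemma within_pair (A : set S) (f : S -> T) (g : S -> U) :
  {within A, continuous f} -> {within A, continuous g} ->
  {within A, continuous (fun x => (f x, g x))}.
Proof. by move=> cf cg x; apply: cvg_pair; [exact: cf|exact: cg]. Qed.

(** Pasting lemma, through preimages of closed sets. [V1] and [V2] describe the preimage only inside
    [A] and [B], so each is cut with its piece before the union is taken. *)
Lemma within_closed_cover (D A B : set T) (f : T -> U) :
  closed A -> closed B -> D `<=` A `|` B ->
  {within D `&` A, continuous f} -> {within D `&` B, continuous f} ->
  {within D, continuous f}.
Proof.
move=> cA cB DAB /continuous_closedP ctsA /continuous_closedP ctsB.
apply/continuous_closedP => W /[dup] /ctsA /closed_subspaceP[V1 cV1 V1W].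
move=> /ctsB /closed_subspaceP[V2 cV2 V2W].
apply/closed_subspaceP; exists ((V1 `&` A) `|` (V2 `&` B)).
  by apply: closedU; exact: closedI.
apply/seteqP; split => x [].
  move=> [[V1x Ax]|[V2x Bx]] Dx; split=> //.
    by have [] : (f @^-1` W `&` (D `&` A)) x by rewrite -V1W.
  by have [] : (f @^-1` W `&` (D `&` B)) x by rewrite -V2W.
move=> Wx Dx; split=> //; case: (DAB _ Dx) => [Ax|Bx]; [left|right].
  by have [] : (V1 `&` (D `&` A)) x by rewrite V1W.
by have [] : (V2 `&` (D `&` B)) x by rewrite V2W.
Qed.

End Within.

Arguments within_comp {S T U A B} f {g}.

(** Pasting along the seam [h x = c], in the form used for all piecewise paths and homotopies below.
    The test selects [f] on the seam, so the agreement of [f] and [g] enters when the second piece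
    is identified. *)
Lemma within_if_le {R : realType} {T U : topologicalType} (D : set T)
    (h : T -> R) (c : R) (f g : T -> U) :
  continuous h ->
  {within D `&` [set x | h x <= c], continuous f} ->
  {within D `&` [set x | c <= h x], continuous g} ->
  (forall x, D x -> h x = c -> f x = g x) ->
  {within D, continuous (fun x => if h x <= c then f x else g x)}.
Proof.
move=> ch cf cg fg.
apply: (@within_closed_cover _ _ _ [set x | h x <= c] [set x | c <= h x]).
- apply: (@preimage_closed _ _ h [set y | y <= c]); last exact: closed_le.
  by move=> x _; exact: ch.
- apply: (@preimage_closed _ _ h [set y | c <= y]); last exact: closed_ge.
  by move=> x _; exact: ch.
- by move=> x _ /=; case: (leP (h x) c); [left|move/ltW; right].
- apply: subspace_eq_continuous cf => x; rewrite inE => -[_ /= hx].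
  by rewrite /from_subspace hx.
- apply: subspace_eq_continuous cg => x; rewrite inE => -[Dx /= hx].
  rewrite /from_subspace; case: ifP => // hx'; apply/esym/fg => //.
  by apply/le_anti; rewrite hx hx'.
Qed.

Lemma unit_intervalE {R : realType} (t : R) :
  unit_interval R t = (0 <= t <= 1) :> Prop.
Proof. by rewrite /unit_interval/= in_itv. Qed.

(** * Symmetry and transitivity of relative homotopy *)

Section HomotopicRel.
Context {R : realType} {T X : topologicalType} {D A : set T}.
Implicit Types f g h : T -> X.
Local Notation I := (unit_interval R).

Hypothesis AD : A `<=` D.

Lemma eq_homotopic_rel f f' g g' :
  (forall y, D y -> f y = f' y) -> (forall y, D y -> g y = g' y) ->
  homotopic_rel R D A f g -> homotopic_rel R D A f' g'.
Proof.
move=> ff gg [H [cH H0 H1 HA]]; exists H; split=> //.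
- by move=> y Dy; rewrite H0// ff.
- by move=> y Dy; rewrite H1// gg.
- by move=> a t Aa It; rewrite HA// ff//; exact: AD.
Qed.

Lemma homotopic_rel_sym f g :
  homotopic_rel R D A f g -> homotopic_rel R D A g f.
Proof.
move=> [H [cH H0 H1 HA]]; exists (fun p => H (p.1, 1 - p.2)); split => /=.
- apply: (within_comp (fun p : T * R => (p.1, 1 - p.2)) cH).
    by apply: continuous_subspaceT; prove_continuous.
  by move=> [y t] [/= Dy /=]; rewrite !unit_intervalE => It; split=> //; lra.
- by move=> y Dy; rewrite subr0 H1.
- by move=> y Dy; rewrite subrr H0.
- move=> a t Aa; rewrite unit_intervalE => It; rewrite HA//; last first.
    by rewrite unit_intervalE; lra.
  by rewrite -H1 ?HA ?unit_intervalE ?lexx ?ler01//; exact: AD.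
Qed.

Lemma homotopic_rel_trans f g h : homotopic_rel R D A f g ->
  homotopic_rel R D A g h -> homotopic_rel R D A f h.
Proof.
move=> [H [cH H0 H1 HA]] [K [cK K0 K1 KA]].
(* The second homotopy is fixed on [A] at the values of [g], the result must be fixed at those of
   [f]; evaluating the first homotopy at time 1 identifies them. *)
have gf a : A a -> g a = f a.
  by move=> Aa; rewrite -H1 ?HA ?unit_intervalE ?lexx ?ler01//; exact: AD.
exists (fun p =>
  if p.2 <= 2^-1 then H (p.1, 2 * p.2) else K (p.1, 2 * p.2 - 1)).
split => /=.
- apply: within_if_le; first prove_continuous.
  + apply: (within_comp (fun p : T * R => (p.1, 2 * p.2)) cH).
      by apply: continuous_subspaceT; prove_continuous.
    move=> [y t] [] [/= Dy /=]; rewrite !unit_intervalE => It ht.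
    by split=> //; lra.
  + apply: (within_comp (fun p : T * R => (p.1, 2 * p.2 - 1)) cK).
      by apply: continuous_subspaceT; prove_continuous.
    move=> [y t] [] [/= Dy /=]; rewrite !unit_intervalE => It ht.
    by split=> //; lra.
  + move=> [y t] [/= Dy _] ->; rewrite divff ?pnatr_eq0//.
    by rewrite subrr H1// K0.
- by move=> y Dy; rewrite ifT ?mulr0 ?H0//; lra.
- by move=> y Dy; rewrite ifF ?mulr1 -?[2 - 1]/(1 + 1 - 1) ?addrK ?K1//; lra.
- move=> a t Aa; rewrite unit_intervalE => It; case: ifPn => ht.
    by rewrite HA// unit_intervalE; lra.
  by rewrite KA ?gf// unit_intervalE; lra.
Qed.

End HomotopicRel.

(** * Reparametrization, reversal and concatenation of paths *)

Section PathHomotopy.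
Context {R : realType} {X : topologicalType}.
Implicit Types w v a : R -> X.
Local Notation I := (unit_interval R).
Local Notation ends := ([set 0; 1] : set R).
Local Notation path_homotopic := (homotopic_rel R I ends).

Lemma unit_interval0 : I 0. Proof. by rewrite unit_intervalE lexx ler01. Qed.

Lemma unit_interval1 : I 1. Proof. by rewrite unit_intervalE lexx ler01. Qed.

Lemma ends_sub_unit_interval : ends `<=` I.
Proof. by move=> t [->|->]; [exact: unit_interval0|exact: unit_interval1]. Qed.

(** The straight-line homotopy from [phi] to [psi] stays in the interval by convexity and is
    stationary where they agree. It supplies the cancellation laws for concatenations. *)
Lemma path_homotopic_reparam a (phi psi : R -> R) :
  {within I, continuous a} ->
  continuous phi -> continuous psi ->
  (forall s, I s -> I (phi s)) -> (forall s, I s -> I (psi s)) ->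
  phi 0 = psi 0 -> phi 1 = psi 1 ->
  path_homotopic (fun s => a (phi s)) (fun s => a (psi s)).
Proof.
move=> ca cphi cpsi Iphi Ipsi e0 e1.
exists (fun p => a (phi p.1 + p.2 * (psi p.1 - phi p.1))); split => /=.
- apply: (within_comp
    (fun p : R * R => phi p.1 + p.2 * (psi p.1 - phi p.1)) ca).
    apply: continuous_subspaceT => -[s t]; rewrite /continuous_at.
    have cs f : continuous f -> (f p.1 : R) @[p --> (s, t)] --> f s.
      by move=> cf; apply: cvg_comp; [exact: cvg_fst|exact: cf].
    by apply: cvgD; [exact: cs|apply: cvgM; [exact: cvg_snd|
      apply: cvgB; exact: cs]].
  move=> [s t] [/= Is]; move: (Iphi _ Is) (Ipsi _ Is).
  by rewrite !unit_intervalE; nra.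
- by move=> s _; rewrite mul0r addr0.
- by move=> s _; rewrite mul1r addrC subrK.
- by move=> s t [->|->] _; rewrite ?e0 ?e1 subrr mulr0 addr0.
Qed.

Definition path_rev w : R -> X := fun s => w (1 - s).

Lemma is_path_rev {p q w} : is_path p q w -> is_path q p (path_rev w).
Proof.
move=> [cw w0 w1]; split; rewrite /path_rev ?subr0 ?subrr//.
apply: (within_comp (fun s : R => 1 - s) cw).
  by apply: continuous_subspaceT; prove_continuous.
by move=> s; rewrite !unit_intervalE; lra.
Qed.

Lemma path_rev_homotopic {w v} : path_homotopic w v ->
  path_homotopic (path_rev w) (path_rev v).
Proof.
move=> [H [cH H0 H1 HA]]; exists (fun p => H (1 - p.1, p.2)); split => /=.
- apply: (within_comp (fun p : R * R => (1 - p.1, p.2)) cH).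
    by apply: continuous_subspaceT; prove_continuous.
  by move=> [s t] [/=]; rewrite !unit_intervalE => Is It; split=> //; lra.
- by move=> s; rewrite unit_intervalE => Is; rewrite H0// unit_intervalE; lra.
- by move=> s; rewrite unit_intervalE => Is; rewrite H1// unit_intervalE; lra.
- by move=> s t [->|->] It; rewrite HA//= ?subr0 ?subrr; [right|left].
Qed.

Lemma is_path_concat {p q r w v} : is_path p q w -> is_path q r v ->
  is_path p r (path_concat w v).
Proof.
move=> [cw w0 w1] [cv v0 v1]; split; rewrite /path_concat.
- apply: (@within_if_le _ _ _ _ id); first prove_continuous.
  + apply: (within_comp (fun s : R => 2 * s) cw).
      by apply: continuous_subspaceT; prove_continuous.
    by move=> s [] /=; rewrite !unit_intervalE => Is hs; lra.
  + apply: (within_comp (fun s : R => 2 * s - 1) cv).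
      by apply: continuous_subspaceT; prove_continuous.
    by move=> s [] /=; rewrite !unit_intervalE => Is hs; lra.
  + by move=> s _ ->; rewrite divff ?pnatr_eq0// subrr w1 v0.
- by rewrite ifT ?mulr0//; lra.
- by rewrite ifF ?mulr1 -?[2 - 1]/(1 + 1 - 1) ?addrK//; lra.
Qed.

Lemma path_concat_homotopic_r {p q r w v v'} :
  is_path p q w -> is_path q r v -> path_homotopic v v' ->
  path_homotopic (path_concat w v) (path_concat w v').
Proof.
move=> [cw w0 w1] [cv v0 v1] [H [cH H0 H1 HA]].
exists (fun p => if p.1 <= 2^-1 then w (2 * p.1) else H (2 * p.1 - 1, p.2)).
rewrite /path_concat; split => /=.
- apply: within_if_le; first prove_continuous.
  + apply: (within_comp (fun p : R * R => 2 * p.1) cw).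
      by apply: continuous_subspaceT; prove_continuous.
    by move=> [s t] [] [] /=; rewrite !unit_intervalE => Is It hs; lra.
  + apply: (within_comp (fun p : R * R => (2 * p.1 - 1, p.2)) cH).
      by apply: continuous_subspaceT; prove_continuous.
    move=> [s t] [] [] /=; rewrite !unit_intervalE => Is It hs.
    by split=> //; lra.
  + move=> [s t] [/= _ It] ->.
    by rewrite divff ?pnatr_eq0// subrr HA//= ?w1 ?v0//; left.
- move=> s; rewrite unit_intervalE => Is; case: ifPn => // hs.
  by rewrite H0// unit_intervalE; lra.
- move=> s; rewrite unit_intervalE => Is; case: ifPn => // hs.
  by rewrite H1// unit_intervalE; lra.
- move=> s t Es It; case: ifPn => // hs; rewrite HA//.
  case: Es hs => -> hs; first by case/negP: hs; rewrite invr_ge0 ler0n.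
  by right; rewrite mulr1 -[2 - 1]/(1 + 1 - 1) addrK.
Qed.

(** The concatenation is [w] composed with the tent map [1 - |1 - 2s|], which vanishes at both ends
    and so deforms to the constant 0. *)
Lemma path_concat_rev {p q w} : is_path p q w ->
  path_homotopic (path_concat w (path_rev w)) (cst p).
Proof.
move=> [cw w0 w1].
apply: (@eq_homotopic_rel _ _ _ _ _ ends_sub_unit_interval
  (fun s => w (1 - `|1 - 2 * s|)) _ (fun=> w 0)).
- move=> s _; rewrite /path_concat /path_rev; case: ifPn => hs; congr w.
    by rewrite ger0_norm; lra.
  by rewrite ler0_norm; lra.
- by move=> s _; rewrite w0.
apply: (path_homotopic_reparam w (fun s => 1 - `|1 - 2 * s|) (cst 0)) => //.
- by prove_continuous.
- by move=> s; exact: cvg_cst.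
- by move=> s; rewrite !unit_intervalE; case: (ler0P (1 - 2 * s)); lra.
- by move=> s _; exact: unit_interval0.
- by rewrite /= mulr0 subr0 normr1 subrr.
- by rewrite /cst ler0_norm; lra.
Qed.

(* Both sides are reparametrizations of [path_concat w v]: the left one runs
   from the midpoint back to the start and then along the whole path. *)
Lemma path_rev_concatK {p q r w v} : is_path p q w -> is_path q r v ->
  path_homotopic (path_concat (path_rev w) (path_concat w v)) v.
Proof.
move=> wP vP; have [cwv _ _] := is_path_concat wP vP.
have [cw w0 w1] := wP; have [cv v0 v1] := vP.
(* The absolute value encodes the change of slope: [phi] is [1/2 - s] up to [s = 1/2] and [2s - 1]
   afterwards. [psi] runs through the second half of the interval, where [v] is traversed. *)
pose phi (s : R) := (s - 2^-1 + `|3 / 2 - 3 * s|) / 2.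
pose psi (s : R) := (1 + s) / 2.
apply: (@eq_homotopic_rel _ _ _ _ _ ends_sub_unit_interval
  (fun s => path_concat w v (phi s)) _ (fun s => path_concat w v (psi s))).
- move=> s; rewrite unit_intervalE => Is; rewrite {2}/path_concat.
  case: ifPn => hs.
    have -> : phi s = 2^-1 - s by rewrite /phi ger0_norm; lra.
    rewrite /path_concat /path_rev ifT; last by lra.
    by congr w; lra.
  by congr path_concat; rewrite /phi ler0_norm; lra.
- move=> s; rewrite unit_intervalE => Is; rewrite /path_concat.
  case: ifPn => hs.
    (* Only at [s = 0] does [psi] hit the midpoint, where [path_concat] reads [w 1], which equals
       [v 0]. *)
    have -> : s = 0 by move: hs; rewrite /psi; lra.
    rewrite v0 -w1; congr w; rewrite /psi; lra.
  by congr v; rewrite /psi; lra.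
apply: path_homotopic_reparam => //.
- by rewrite /phi; prove_continuous.
- by rewrite /psi; prove_continuous.
- move=> s; rewrite !unit_intervalE /phi => Is.
  by case: (ler0P (3 / 2 - 3 * s)); lra.
- by move=> s; rewrite !unit_intervalE /psi; lra.
- by rewrite /phi /psi ger0_norm; lra.
- by rewrite /phi /psi ler0_norm; lra.
Qed.

End PathHomotopy.

(** * Passage between loops on the interval and maps on the circle *)

Section CircleLoops.
Context {R : realType} {X : topologicalType}.
Implicit Types w v : R -> X.
Local Notation I := (unit_interval R).
Local Notation circle := (circle R).
Local Notation circle_pt := (circle_pt R).
Local Notation ends := ([set 0; 1] : set R).

(* The parameter is affine in the first coordinate on each half circle, from
   [circle_pt] through the upper half first; it is inverted by
   [circle_param]. *)
Definition circle_of_loop w : R * R -> X :=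
  fun z => if z.2 <= 0 then w ((3 + z.1) / 4) else w ((1 - z.1) / 4).

(* [Num.sqrt] vanishes on negative numbers, so only the first square root
   contributes for [s <= 1/2] and only the second one for [s >= 1/2]. *)
Definition circle_param (s : R) : R * R :=
  (`|4 * s - 2| - 1,
   Num.sqrt (8 * s * (1 - 2 * s)) - Num.sqrt (8 * (2 * s - 1) * (1 - s))).

(** The lower half of the parameter interval covers the upper half circle; the radicand is
    [1 - (1 - 4s)^2]. *)
Lemma circle_param_lower_half (s : R) : 0 <= s <= 2^-1 ->
  circle_param s = (1 - 4 * s, Num.sqrt (8 * s * (1 - 2 * s))).
Proof.
move=> hs; rewrite /circle_param ler0_norm; last by lra.
rewrite (@ler0_sqrtr _ (8 * (2 * s - 1) * (1 - s))) ?subr0; last by nra.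
by congr pair; lra.
Qed.

Lemma circle_param_upper_half (s : R) : 2^-1 <= s <= 1 ->
  circle_param s = (4 * s - 3, - Num.sqrt (8 * (2 * s - 1) * (1 - s))).
Proof.
move=> hs; rewrite /circle_param ger0_norm; last by lra.
rewrite (@ler0_sqrtr _ (8 * s * (1 - 2 * s))) ?sub0r; last by nra.
by congr pair; lra.
Qed.

Lemma continuous_circle_param : continuous circle_param.
Proof. by rewrite /circle_param; prove_continuous. Qed.

Lemma circle_circle_param (s : R) : I s -> circle (circle_param s).
Proof.
rewrite unit_intervalE => Is; have [hs|hs] := leP s 2^-1.
  rewrite circle_param_lower_half; last by lra.
  by rewrite /circle/= sqr_sqrtr; nra.
rewrite circle_param_upper_half; last by lra.
by rewrite /circle/= sqrrN sqr_sqrtr; nra.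
Qed.

Lemma circle_param_ends (s : R) : ends s -> circle_param s = circle_pt.
Proof.
case=> ->.
  rewrite circle_param_lower_half; last by lra.
  by rewrite !mulr0 mul0r sqrtr0 subr0.
rewrite circle_param_upper_half; last by lra.
by rewrite subrr mulr0 sqrtr0 oppr0 /circle_pt; congr pair; lra.
Qed.

Lemma circle_of_loopK w s : w 0 = w 1 -> I s ->
  circle_of_loop w (circle_param s) = w s.
Proof.
rewrite unit_intervalE /circle_of_loop => w01 Is; have [hs|hs] := leP s 2^-1.
  rewrite circle_param_lower_half/=; last by lra.
  (* The branch meant for the lower half circle is entered only where the square root vanishes: at
     [s = 0], settled by [w 0 = w 1], and at [s = 1/2], where both branches read the same
     parameter. *)
  case: ifPn => [|_]; last by congr w; lra.
  rewrite -(sqrtr0 R) ler_sqrt// => h.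
  have [->|s0] := eqVneq s 0; first by rewrite w01; congr w; lra.
  have s_gt0 : 0 < s by rewrite lt_def s0; lra.
  by congr w; nra.
rewrite circle_param_upper_half/=; last by lra.
by rewrite oppr_le0 sqrtr_ge0; congr w; lra.
Qed.

(** The base point has second coordinate 0, so the test selects the end of [w] and not its start. *)
Lemma circle_of_loop_pt w : circle_of_loop w circle_pt = w 1.
Proof. by rewrite /circle_of_loop /= lexx; congr w; lra. Qed.

Lemma circle_coord_le1 (z : R * R) : circle z -> -1 <= z.1 <= 1.
Proof. by rewrite /circle/= => hz; apply/andP; split; nra. Qed.

Lemma circle_of_loop_image w : circle_of_loop w @` circle `<=` w @` I.
Proof.
move=> _ [z /circle_coord_le1 hz <-]; rewrite /circle_of_loop.
by case: ifPn => _; [exists ((3 + z.1) / 4)|exists ((1 - z.1) / 4)] => //;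
  rewrite unit_intervalE; lra.
Qed.

(** The half circles meet at [(1, 0)], where the parameters are 1 and 0 and the hypothesis on [H]
    applies, and at [(-1, 0)], where both are [1/2]. Single loops are covered by a homotopy
    independent of time. *)
Lemma within_circle_of_loop (H : R * R -> X) :
  {within I `*` I, continuous H} -> (forall t, I t -> H (0, t) = H (1, t)) ->
  {within circle `*` I,
    continuous (fun p => circle_of_loop (fun s => H (s, p.2)) p.1)}.
Proof.
move=> cH H01; rewrite /circle_of_loop; apply: within_if_le.
- by prove_continuous.
- apply: (within_comp (fun p : R * R * R => ((3 + p.1.1) / 4, p.2)) cH).
    by apply: continuous_subspaceT; prove_continuous.
  move=> [z t] [] [/= /circle_coord_le1 hz]; rewrite !unit_intervalE => It _.
  by split => //; lra.
- apply: (within_comp (fun p : R * R * R => ((1 - p.1.1) / 4, p.2)) cH).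
    by apply: continuous_subspaceT; prove_continuous.
  move=> [z t] [] [/= /circle_coord_le1 hz]; rewrite !unit_intervalE => It _.
  by split => //; lra.
- move=> [[x y] t] [/= + It] y0; rewrite /circle/= y0 expr0n addr0 => /eqP.
  rewrite sqrf_eq1 => /orP[]/eqP ->; last by congr H; congr pair; lra.
  by rewrite subrr mul0r H01//; congr H; congr pair; lra.
Qed.

Lemma closed_curve_circle_of_loop x w :
  is_loop x w -> closed_curve (circle_of_loop w).
Proof.
move=> [cw w0 w1].
apply: (within_comp (fun z : R * R => (z, 0))
  (@within_circle_of_loop (fun p => w p.1) _ _)).
- apply: (within_comp (fun p : R * R => p.1) cw).
    by apply: continuous_subspaceT; prove_continuous.
  by move=> ? [].
- by move=> t _ /=; rewrite w0 w1.
- by apply: continuous_subspaceT; prove_continuous.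
- by move=> z Cz; split => //=; exact: unit_interval0.
Qed.

Lemma homotopic_circle_of_loop x w v : is_loop x w ->
  homotopic_rel R I ends w v ->
  homotopic_rel R circle [set circle_pt] (circle_of_loop w) (circle_of_loop v).
Proof.
move=> [_ w0 w1] [H [cH H0 H1 HA]].
exists (fun p => circle_of_loop (fun s => H (s, p.2)) p.1); split => /=.
- apply: within_circle_of_loop => // t It.
  by rewrite !HA ?w0 ?w1//; [right|left].
- move=> z /circle_coord_le1 hz; rewrite /circle_of_loop.
  by case: ifPn => _; rewrite H0// unit_intervalE; lra.
- move=> z /circle_coord_le1 hz; rewrite /circle_of_loop.
  by case: ifPn => _; rewrite H1// unit_intervalE; lra.
- by move=> _ t -> It; rewrite !circle_of_loop_pt HA//; right.
Qed.

(** The homotopy is pulled back along [circle_param], which sends both ends of the interval to the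
    base point; [circle_of_loopK] recovers [w] and [v]. *)
Lemma circle_of_loop_homotopic {x w v} : is_loop x w -> is_loop x v ->
  homotopic_rel R circle [set circle_pt]
    (circle_of_loop w) (circle_of_loop v) ->
  homotopic_rel R I ends w v.
Proof.
move=> [_ w0 w1] [_ v0 v1] [K [cK K0 K1 KA]].
exists (fun p => K (circle_param p.1, p.2)); split => /=.
- apply: (within_comp (fun p : R * R => (circle_param p.1, p.2)) cK).
    apply: continuous_subspaceT; apply: continuous_pair.
      move=> p; apply: cvg_comp; first exact: cvg_fst.
      exact: continuous_circle_param.
    by prove_continuous.
  by move=> [s t] [/= Is It]; split => //; exact: circle_circle_param.
- move=> s Is; rewrite K0; last exact: circle_circle_param.
  by rewrite circle_of_loopK// w0 w1.
- move=> s Is; rewrite K1; last exact: circle_circle_param.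
  by rewrite circle_of_loopK// v0 v1.
- move=> s t Es It; rewrite circle_param_ends// KA//.
  by rewrite circle_of_loop_pt; case: Es => ->; rewrite w1 ?w0.
Qed.

End CircleLoops.

(** * Homotopy classes of loops, and uniform continuity of paths *)

Section LoopClasses.
Context {R : realType} {X : topologicalType}.
Implicit Types w v : R -> X.

Lemma is_loop_cst (x : X) : is_loop x (cst x : R -> X).
Proof. by split => //; apply: continuous_subspaceT => ?; exact: cvg_cst. Qed.

Lemma loop_class_eq x w v :
  homotopic_rel R (unit_interval R) [set 0; 1] w v ->
  loop_class x w = loop_class x v.
Proof.
move=> wv; apply/seteqP; split=> u [xu h]; split => //.
  apply: homotopic_rel_trans h; first exact: ends_sub_unit_interval.
  by apply: homotopic_rel_sym => //; exact: ends_sub_unit_interval.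
by apply: homotopic_rel_trans h => //; exact: ends_sub_unit_interval.
Qed.

End LoopClasses.

(** Heine-Cantor, phrased by the mesh of a uniform partition. Compactness as a near-covering
    property makes a mesh valid near each point valid on the whole interval. *)
Lemma within_unit_interval_unif_continuous {R : realType} {X : metricType R}
    (w : R -> X) (eps : R) :
  {within unit_interval R, continuous w} -> 0 < eps ->
  \forall n \near \oo, forall s t : R, unit_interval R s -> unit_interval R t ->
    `|s - t| <= n.+1%:R^-1 -> mdist (w s) (w t) < eps.
Proof.
move=> /subspace_continuousP cw eps0.
have /compact_near_coveringP/near_covering_withinP cov :
  compact (unit_interval R) by exact: segment_compact.
pose P (n : nat) (s : R) := forall t : R, unit_interval R t ->
  `|s - t| <= n.+1%:R^-1 -> mdist (w s) (w t) < eps.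
suff nears s : unit_interval R s ->
    \forall r \near s & n \near \oo, unit_interval R r -> P n r.
  by apply: filterS (cov _ _ P _ nears) => n Pn s t Is; apply: Pn.
move=> Is.
have eps2 : 0 < eps / 2 by rewrite divr_gt0.
have /nbhs_ballP[d /= d0 wd] : nbhs s (fun t => unit_interval R t ->
    mdist (w s) (w t) < eps / 2).
  have := cw s Is _ (nbhsx_ballx (w s) _ eps2).
  by rewrite ballEmdist.
(* Halving [d] keeps [t] within [d] of the centre [s], passing through [s']; halving [eps] serves
   the comparison of [w s'] with [w t] through [w s]. *)
have d2 : 0 < d / 2 by rewrite divr_gt0.
near=> s' n => Is' t It st.
have ss' : `|s - s'| < d / 2.
  by near: s'; apply: (nbhsx_ballx s _ d2).
have nd : n.+1%:R^-1 < d / 2.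
  by near: n; exact: (near_infty_natSinv_lt (PosNum d2)).
rewrite (splitr eps) (le_lt_trans (metric_triangle _ (w s) _))// ltrD//.
  rewrite metric_sym; apply: wd => //; rewrite /ball/=; lra.
apply: wd => //; rewrite /ball/=.
rewrite (le_lt_trans (ler_distD s' s t))// (splitr d) ltrD//.
exact: le_lt_trans nd.
Unshelve. all: end_near.
Qed.

(** * Small loops, pointed and free *)

Lemma homotopically_Hausdorff_of_pointed_small_loops (R : realType)
    (X : topologicalType) :
  (~ exists (x0 : X) (f : R * R -> X),
      pointed_small_loop x0 f /\ ~ trivial_pointed_loop f) ->
  homotopically_Hausdorff R X.
Proof.
move=> noloop x0 _ [w0 lw0 <-] nontriv; apply: contrapT => noU; apply: noloop.
have [_ w00 w01] := lw0.
exists x0, (circle_of_loop w0); split; last first.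
  rewrite /trivial_pointed_loop circle_of_loop_pt w01 => triv.
  (* A contraction on the circle is carried back to the interval, since the constant loop induces
     the constant map. *)
  apply/nontriv/loop_class_eq/(circle_of_loop_homotopic lw0 (is_loop_cst x0)).
  apply: eq_homotopic_rel triv => //.
  - by move=> _ ->; rewrite /circle /circle_pt/= expr1n expr0n addr0.
  - by move=> z _; rewrite /circle_of_loop /cst if_same.
split; first exact: closed_curve_circle_of_loop lw0.
  by rewrite circle_of_loop_pt w01.
(* Were there no such [g], [U] itself would exclude the class of [w0]: a representative inside [U]
   induces a suitable [g]. *)
move=> U oU Ux0; apply: contrapT => nog; apply: noU.
exists U; first exact: open_nbhs_nbhs.
move=> w lw wU [_ w0w]; apply: nog; exists (circle_of_loop w); split.
- exact: closed_curve_circle_of_loop lw.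
- exact: subset_trans (circle_of_loop_image w) wU.
- exact: homotopic_circle_of_loop lw0 w0w.
Qed.

Lemma strongly_homotopically_Hausdorff_of_free_small_loops (R : realType)
    (X : topologicalType) :
  (~ exists f : R * R -> X, free_small_loop f /\ ~ null_homotopic f) ->
  strongly_homotopically_Hausdorff R X.
Proof.
move=> noloop x0 f cf essential; apply: contrapT => noU; apply: noloop.
exists f; split => //; split => //; exists x0 => U oU Ux0.
apply: contrapT => nog; apply: noU; exists U; first exact: open_nbhs_nbhs.
by move=> g cg gU fg; apply: nog; exists g.
Qed.

(** * Uniform partitions of a path and covers by small balls *)

Lemma uniform_partition_cell {R : realType} (k : nat) (s : R) :
  (0 < k)%N -> unit_interval R s ->
  exists2 j, (1 <= j <= k)%N & j.-1%:R / k%:R <= s <= j%:R / k%:R.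
Proof.
move=> k0; rewrite unit_intervalE => /andP[s0 s1].
have kR : 0 < k%:R :> R by rewrite ltr0n.
(* The least such [j] gives the cell, as its predecessor fails the inequality. It is 0 only for
   [s = 0], which is put into the first cell. *)
have /ex_minnP[[|j] sj minj] : exists j, s <= j%:R / k%:R.
- by exists k; rewrite divff ?gt_eqF.
- exists 1%N; rewrite /= ?mul0r ?s0 ?(le_trans sj)// mul0r.
  by rewrite divr_ge0 ?ler0n.
- have jk : (j.+1 <= k)%N by apply: minj; rewrite divff ?gt_eqF.
  exists j.+1; rewrite ?jk//= sj andbT leNgt; apply/negP => /ltW /minj.
  by rewrite ltnn.
Qed.

Lemma open_metric_ball {R : realType} {X : metricType R} (x : X) (e : R) :
  open (ball x e).
Proof.
rewrite openE => y; rewrite ballEmdist/= => xy.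
apply/nbhs_ballP; exists (e - mdist x y); first by rewrite /= subr_gt0.
move=> z; rewrite !ballEmdist/= => yz.
by rewrite (le_lt_trans (metric_triangle _ y _))// -ltrBrDl.
Qed.

(** The cover consists of balls of radius [eps / 2] about the values of [w] at left end points, with
    a mesh on which [w] varies by less than [eps / 2]. *)
Lemma uniform_partition_cover {R : realType} {X : metricType R} {p q : X}
    {w : R -> X} {eps : R} : is_path p q w -> 0 < eps ->
  exists (k : nat) (P : nat -> X) (U : nat -> set X) (t : nat -> R),
    [/\ P 1%N = p /\ P k = q,
        forall j, (1 <= j <= k)%N -> open (U j),
        w @` unit_interval R `<=` \bigcup_(j in [set j | (1 <= j <= k)%N]) U j,
        [/\ t 0%N = 0, t k = 1 & forall j, (1 <= j <= k)%N -> t j.-1 < t j]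
      & (forall j, (1 <= j <= k)%N ->
          w @` `[t j.-1, t j]%classic `<=` U j /\
          (w @` `[t j.-1, t j]%classic) (P j)) /\
        forall v : R -> X,
          (forall j, (1 <= j <= k)%N ->
            v @` `[t j.-1, t j]%classic `<=` U (k - j + 1)%N) ->
          forall s, unit_interval R s -> mdist (path_rev v s) (w s) < eps].
Proof.
move=> [cw w0 w1] eps0; have eps2 : 0 < eps / 2 by rewrite divr_gt0.
(* With [n] positive there are at least two cells, so that [P 1] and [P k] can be the distinct ends
   of [w]. *)
have [n n0 unif] : exists2 n, (0 < n)%N & forall s t : R,
    unit_interval R s -> unit_interval R t ->
    `|s - t| <= n.+1%:R^-1 -> mdist (w s) (w t) < eps / 2.
  have : \forall n \near \oo, (0 < n)%N /\ forall s t : R,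
      unit_interval R s -> unit_interval R t ->
      `|s - t| <= n.+1%:R^-1 -> mdist (w s) (w t) < eps / 2.
    apply: filterI; first exact: nbhs_infty_gt.
    exact: within_unit_interval_unif_continuous.
  by move=> /filter_ex[n []]; exists n.
pose k := n.+1; pose t (j : nat) : R := j%:R / k%:R.
have kR : 0 < k%:R :> R by rewrite ltr0n.
have It j : (j <= k)%N -> unit_interval R (t j).
  move=> jk; rewrite unit_intervalE /t divr_ge0 ?ler0n//=.
  by rewrite ler_pdivrMr// mul1r ler_nat.
have tS j : t j.+1 = t j + k%:R^-1 by rewrite /t -natr1 mulrDl mul1r.
have tcell j s : t j <= s <= t j.+1 -> `|t j - s| <= k%:R^-1.
  move=> /andP[sj]; rewrite tS => js.
  by rewrite ler_norml; apply/andP; split; lra.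
have cellI j s : (j.+1 <= k)%N -> t j <= s <= t j.+1 -> unit_interval R s.
  move=> jk hs; have := It j (ltnW jk); have := It _ jk.
  by rewrite !unit_intervalE; lra.
pose U j := ball (w (t j.-1)) (eps / 2).
have wU j : (1 <= j <= k)%N -> w @` `[t j.-1, t j]%classic `<=` U j.
  case: j => // j jk _ [s /= + <-]; rewrite in_itv/= => hs.
  rewrite /U ballEmdist/=; apply: unif; [exact: It (ltnW jk)| |exact: tcell].
  exact: cellI hs.
exists k, (fun j => if j == k then w 1 else w (t j.-1)), U, t; split.
- by rewrite eqxx ifN ?[1%N == _]eq_sym ?eqSS -?lt0n//= /t mul0r.
- by move=> j _; exact: open_metric_ball.
- move=> _ [s Is <-]; have [j jk hs] := @uniform_partition_cell R k s isT Is.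
  by exists j => //; apply: wU => //; exists s => //=; rewrite in_itv.
- rewrite /t mul0r divff ?gt_eqF//; split => // -[//|j] _.
  by rewrite -[ltLHS]/(t j) -[ltRHS]/(t j.+1) tS ltrDl invr_gt0.
split=> [j jk|v vU s Is].
  split; first exact: wU.
  case: ifP => [/eqP ->|_].
    exists 1 => //=; rewrite in_itv/= /t divff ?gt_eqF// lexx andbT.
    by rewrite ler_pdivrMr// mul1r ler_nat.
  exists (t j.-1) => //=; rewrite in_itv/= lexx/=.
  by case: j jk => // j _; rewrite tS lerDl invr_ge0 ltW.
(* [path_rev v s] is [v] at time [1 - s]. If that time lies in cell [j], then [s] lies in cell
   [k - j + 1], whose left end is [1 - t j]; both [v (1 - s)] and [w s] are then within [eps / 2] of
   the centre of the corresponding ball. *)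
have [|j jk hs] := @uniform_partition_cell R k (1 - s) isT.
  by move: Is; rewrite !unit_intervalE; lra.
case/andP: (jk) => j1 j2.
have : U (k - j + 1)%N (v (1 - s)).
  by apply: (vU j jk); exists (1 - s) => //=; rewrite in_itv.
rewrite /U addn1/= ballEmdist/= metric_sym => vs.
rewrite (splitr eps) (le_lt_trans (metric_triangle _ (w (t (k - j)%N)) _))//.
rewrite ltrD//; apply: unif => //; first by apply: It; exact: leq_subr.
have tkj : t (k - j)%N = 1 - t j by rewrite /t natrB// mulrBl divff ?gt_eqF.
case: j j1 {jk vs} j2 hs tkj => // j _ j2; rewrite -[_%:R / _]/(t j).
rewrite -[j.+1%:R / _]/(t j.+1) => /andP[h1 h2] ->.
by move: h2; rewrite !tS ler_norml -/k => h2; apply/andP; split; lra.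
Qed.

(** * Close paths obtained from return paths *)

Lemma homotopically_path_Hausdorff_of_no_close_paths (R : realType)
    (X : metricType R) :
  (~ exists f g : R -> X,
      [/\ {within unit_interval R, continuous f},
          {within unit_interval R, continuous g}
        & close_rel (unit_interval R) [set 0; 1] f g]) ->
  homotopically_path_Hausdorff R X.
Proof.
move=> noclose p q w wP _ [w0 lw0 <-] nontriv; apply: contrapT => nopart.
have return_path eps : 0 < eps -> exists v, [/\ is_path q p v,
    homotopic_rel R (unit_interval R) [set 0; 1] w0 (path_concat w v) &
    forall s, unit_interval R s -> mdist (path_rev v s) (w s) < eps].
  move=> eps0; apply: contrapT => nov; apply: nopart.
  have [k [P [U [t [? ? ? ? [? close]]]]]] := uniform_partition_cover wP eps0.
  exists k, P, U, t; split => //; split => // v vP vU [_ w0v].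
  by apply: nov; exists v; split => //; apply: close => j /vU[].
have ends := @ends_sub_unit_interval R.
(* The tolerance 1 is arbitrary: what matters about [v1] is that [w] followed by it is homotopic to
   [w0]. *)
have [v1 [v1P w0v1 _]] := return_path 1 ltr01.
have v1revP := is_path_rev v1P.
apply: noclose; exists (path_rev v1), w; split; [by case: v1revP|by case: wP|].
split=> [v1w|eps eps0].
  (* If the reverse of [v1] deforms to [w], then [v1] deforms to the reverse of [w], and [w0] is
     homotopic to [w] followed by its reverse, hence to a constant. *)
  apply/nontriv/loop_class_eq; apply: homotopic_rel_trans w0v1 _ => //.
  apply: homotopic_rel_trans (path_concat_rev wP) => //.
  apply: path_concat_homotopic_r wP v1P _.
  apply: eq_homotopic_rel (path_rev_homotopic v1w) => // s _.
  by rewrite /path_rev subKr.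
have [v [vP w0v vw]] := return_path _ eps0.
(* [w] followed by [v1] and [w] followed by [v] are both homotopic to [w0]; prefixing the reverse of
   [w] cancels [w]. *)
have /path_rev_homotopic [H [cH H0 H1 HA]] :
    homotopic_rel R (unit_interval R) [set 0; 1] v1 v.
  apply: homotopic_rel_trans (path_rev_concatK wP vP) => //.
  apply: (@homotopic_rel_trans _ _ _ _ _ _ _
    (path_concat (path_rev w) (path_concat w v1))) => //.
    by apply: homotopic_rel_sym => //; exact: path_rev_concatK wP v1P.
  apply: path_concat_homotopic_r (is_path_rev wP) _ _.
    exact: is_path_concat wP v1P.
  by apply: homotopic_rel_trans w0v => //; exact: homotopic_rel_sym.
exists H; split => //.
  (* Closeness asks for the values of [w] on the ends, while [H] keeps those of the reverse of [v1];
     both paths run from [p] to [q]. *)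
  move=> a t Aa It; rewrite HA//; case: v1revP wP => _ r0 r1 [_ w_0 w_1].
  by case: Aa => ->; rewrite ?r0 ?r1.
by move=> y Iy; rewrite H1//; exact: vw.
Qed.

Theorem theorem4 (R : realType) :
  (forall X : topologicalType, path_connected R [set: X] ->
     ((~ exists (x0 : X) (f : R * R -> X),
          pointed_small_loop x0 f /\ ~ trivial_pointed_loop f) ->
        homotopically_Hausdorff R X) /\
     ((~ exists f : R * R -> X, free_small_loop f /\ ~ null_homotopic f) ->
        strongly_homotopically_Hausdorff R X)) /\
  (forall X : metricType R, path_connected R [set: X] ->
     locally_path_connected R X ->
     (~ exists f g : R -> X,
          [/\ {within unit_interval R, continuous f},
              {within unit_interval R, continuous g}
            & close_rel (unit_interval R) [set 0; 1] f g]) ->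
     homotopically_path_Hausdorff R X).
Proof.
split=> [X _|X _ _]; last exact: homotopically_path_Hausdorff_of_no_close_paths.
split; first exact: homotopically_Hausdorff_of_pointed_small_loops.
exact: strongly_homotopically_Hausdorff_of_free_small_loops.
Qed.
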